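(* Let $X$ be a metrizable space. Then $X$ is $0$-dimensional and compact if and only if the set of all uniformly disconnected metrics in $\mathrm{Met}(X)$ is a dense $F_{\sigma}$ subset of $(\mathrm{Met}(X), \mathcal{D}_X)$.
   Context: For a metrizable space $X$, $\mathrm{Met}(X)$ denotes the set of all metrics on $X$ generating the given topology of $X$, and $\mathcal{D}_X(d,e)=\sup_{x,y\in X}|d(x,y)-e(x,y)|$ (a possibly $\infty$-valued metric on $\mathrm{Met}(X)$, which carries the induced topology). ''$0$-dimensional'' means covering dimension $0$. A metric space $(X,d)$ is uniformly disconnected if there exists $\delta\in(0,1)$ such that for every non-constant finite sequence $z_1,\dots,z_N$ in $X$ one has $\delta\, d(z_1,z_N)\le\max_{1\le i\le N-1} d(z_i,z_{i+1})$. A subset is $F_\sigma$ if it is a countable union of closed sets. *)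

(* Defs.v *)
From HB Require Import structures.
From mathcomp Require Import all_boot all_order all_algebra.
From mathcomp Require Import all_classical all_reals.
From mathcomp Require Import ereal topology normedtype.
Set Implicit Arguments. Unset Strict Implicit. Unset Printing Implicit Defensive.
Import Order.TTheory GRing.Theory Num.Theory.
Local Open Scope classical_set_scope.
Local Open Scope ring_scope.

Section MetDefs.
Variables (R : realType) (X : topologicalType).

Definition is_metric (d : X -> X -> R) : Prop :=
  (forall x y, d x y = 0 <-> x = y) /\
  (forall x y, d x y = d y x) /\
  (forall x y z, d x z <= d x y + d y z).

Definition generates_topology (d : X -> X -> R) : Prop :=
  forall U : set X, open U <->
    (forall x, U x -> exists2 r : R, 0 < r & [set y | d x y < r] `<=` U).

Definition metrizable : Prop :=
  exists d : X -> X -> R, is_metric d /\ generates_topology d.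

Definition Met : set (X -> X -> R) :=
  [set d | is_metric d /\ generates_topology d].

Definition DX (d e : X -> X -> R) : \bar R :=
  ereal_sup (range (fun p : X * X => (`|d p.1 p.2 - e p.1 p.2|)%:E)).

(* uniformly disconnected metric; a finite sequence z_1..z_N is z 0 .. z N *)
Definition unif_disconnected (d : X -> X -> R) : Prop :=
  exists2 delta : R, 0 < delta < 1 &
    forall (N : nat) (z : nat -> X),
      (exists i j, (i <= N)%N /\ (j <= N)%N /\ z i <> z j) ->
      delta * d (z 0%N) (z N) <= \big[Num.max/0]_(i < N) d (z i) (z i.+1).

Definition UD : set (X -> X -> R) := [set d | Met d /\ unif_disconnected d].

Definition open_in_Met (A : set (X -> X -> R)) : Prop :=
  A `<=` Met /\
  forall d, A d -> exists2 eps : R, 0 < eps &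
    forall e, Met e -> (DX d e < eps%:E)%E -> A e.

Definition closed_in_Met (A : set (X -> X -> R)) : Prop :=
  A `<=` Met /\ open_in_Met (Met `\` A).

Definition dense_in_Met (A : set (X -> X -> R)) : Prop :=
  A `<=` Met /\
  forall B, open_in_Met B -> B !=set0 -> (A `&` B) !=set0.

Definition Fsigma_in_Met (A : set (X -> X -> R)) : Prop :=
  exists F : nat -> set (X -> X -> R),
    (forall n, closed_in_Met (F n)) /\ A = \bigcup_n F n.

End MetDefs.

Definition covering_dim_le0 (X : topologicalType) : Prop :=
  forall (n : nat) (U : 'I_n -> set X),
    (forall i, open (U i)) -> \bigcup_i U i = [set: X] ->
    exists (m : nat) (V : 'I_m -> set X),
      [/\ (forall j, open (V j)), \bigcup_j V j = [set: X],
          (forall j, exists i, V j `<=` U i) &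
          (forall j k, j <> k -> V j `&` V k = set0)].

(* Main.v *)
Require Import Defs.
From HB Require Import structures.
From mathcomp Require Import all_boot all_order all_algebra.
From mathcomp Require Import all_classical all_reals.
From mathcomp Require Import ereal topology normedtype.
From mathcomp Require Import lra ring.

(** Uniform disconnectedness with a fixed constant is a closed condition, so the
    uniformly disconnected metrics always form an F_sigma set.

    If X is compact and 0-dimensional, finite clopen partitions of mesh tending to
    0 give an ultrametric u on X. Replacing d by d(f x, f y) + c u(x, y), where f
    sends x to a representative of its block in a fine partition, changes d little,
    and the result is bi-Lipschitz equivalent to u, hence uniformly disconnected.

    Conversely, a continuous function unbounded above yields a metric containing a
    chain with bounded steps that escapes to infinity, and this survives bounded
    perturbations. So density forces continuous functions to be bounded above;
    applied to inverses of positive Lipschitz functions, this gives total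
    boundedness and Lebesgue numbers, hence compactness. For a uniformly
    disconnected metric, the classes of points joined by chains of small steps
    form a finite clopen partition refining a given cover. *)

Set Implicit Arguments. Unset Strict Implicit. Unset Printing Implicit Defensive.
Import Order.TTheory GRing.Theory Num.Theory.
Local Open Scope classical_set_scope.
Local Open Scope ring_scope.

(** * Archimedean bound and finite maxima *)

Lemma invSn_lt (R : realType) (eps : R) :
  0 < eps -> exists n, n.+1%:R^-1 < eps.
Proof.
move=> eps0; exists (Num.truncn eps^-1).
by rewrite invf_plt ?posrE // truncnS_gt.
Qed.

Lemma bigmax_ord_ge (R : realType) (N : nat) (f : nat -> R) (i : nat) :
  (i < N)%N -> f i <= \big[Num.max/0]_(j < N) f j.
Proof.
by move=> iN; rewrite (le_bigmax 0 (fun j : 'I_N => f j) (Ordinal iN)).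
Qed.

Lemma bigmax_ord_ge0 (R : realType) (N : nat) (f : nat -> R) :
  0 <= \big[Num.max/0]_(j < N) f j.
Proof. exact: bigmax_ge_id. Qed.

Lemma bigmax_ord_le (R : realType) (N : nat) (f : nat -> R) (B : R) :
  0 <= B -> (forall i, (i < N)%N -> f i <= B) ->
  \big[Num.max/0]_(j < N) f j <= B.
Proof. by move=> B0 fB; apply: bigmax_le => // i _; apply: fB. Qed.

(** * Metrics generating the topology, and the F_sigma property *)

Section Metrics.
Variables (R : realType) (X : topologicalType).
Implicit Types (d e : X -> X -> R) (x y : X).

Lemma metric_refl d : is_metric d -> forall x, d x x = 0.
Proof. by case=> h _ x; apply/h. Qed.

Lemma metric_sym d : is_metric d -> forall x y, d x y = d y x.
Proof. by case=> _ []. Qed.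

Lemma metric_triangle d :
  is_metric d -> forall x y z, d x z <= d x y + d y z.
Proof. by case=> _ []. Qed.

Lemma metric_ge0 d : is_metric d -> forall x y, 0 <= d x y.
Proof.
move=> md x y; have := metric_triangle md x y x.
by rewrite (metric_refl md) (metric_sym md y x); lra.
Qed.

Lemma open_metric_ball d x (r : R) : Met d -> open [set y | d x y < r].
Proof.
case=> md gd; apply/gd => y /= dxy; exists (r - d x y); first by lra.
by move=> z /= dyz; have := metric_triangle md x y z; lra.
Qed.

Lemma nbhs_metric_ball d x (r : R) :
  Met d -> 0 < r -> nbhs x [set y | d x y < r].
Proof.
move=> Md r0; apply: open_nbhs_nbhs; split; first exact: open_metric_ball.
by rewrite /= (metric_refl Md.1).
Qed.

Lemma nbhs_metric d x (A : set X) : Met d -> nbhs x A ->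
  exists2 r : R, 0 < r & [set y | d x y < r] `<=` A.
Proof.
case=> md gd; rewrite nbhsE => -[U [oU Ux] UA].
have /gd/(_ _ Ux) [r r0 rU] := oU.
by exists r => //; apply: subset_trans UA.
Qed.

Lemma Met_equiv d e : Met d -> is_metric e ->
  (forall x (r : R), 0 < r ->
     exists2 s : R, 0 < s & forall y, d x y < s -> e x y < r) ->
  (forall x (r : R), 0 < r ->
     exists2 s : R, 0 < s & forall y, e x y < s -> d x y < r) ->
  Met e.
Proof.
move=> [md gd] me de ed; split=> // U; split.
  move=> /gd oU x /oU [r r0 rU]; have [s s0 sr] := ed x r r0.
  by exists s => // y /sr /rU.
move=> oU; apply/gd => x /oU [r r0 rU]; have [s s0 sr] := de x r r0.
by exists s => // y /sr /rU.
Qed.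

Lemma DX_lt d e (eps : R) x y :
  (DX d e < eps%:E)%E -> `|d x y - e x y| < eps.
Proof.
move=> h; rewrite -lte_fin; apply: le_lt_trans h.
by apply: ereal_sup_ubound; exists (x, y).
Qed.

Lemma DX_le d e (a : R) :
  (forall x y, `|d x y - e x y| <= a) -> (DX d e <= a%:E)%E.
Proof. by move=> h; apply: ge_ereal_sup => _ [[x y] _ <-]; rewrite lee_fin. Qed.

Lemma dense_in_MetP (A : set (X -> X -> R)) : A `<=` @Met R X ->
  dense_in_Met A <->
  (forall d (eps : R), Met d -> 0 < eps ->
     exists2 e, A e & forall x y, `|d x y - e x y| <= eps).
Proof.
move=> AM; split=> [[_ dA] d eps Md eps0|dA].
  (* The uniform bound [a < eps] leaves the slack [eps - a] that makes [B] open for [DX]; a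
     pointwise strict bound by [eps] would not. *)
  pose B : set (X -> X -> R) := [set e | Met e /\
    exists2 a : R, a < eps & forall x y, `|d x y - e x y| <= a].
  have oB : open_in_Met B.
    split=> [e []//|e [Me [a aeps ha]]].
    exists ((eps - a) / 2) => [|e' Me' ee']; first by lra.
    split=> //; exists (a + (eps - a) / 2) => [|x y]; first by lra.
    apply: le_trans (ler_distD (e x y) _ _) _.
    by rewrite lerD // ltW // DX_lt.
  have [|e [Ae [_ [a aeps ha]]]] := dA B oB.
    exists d; split=> //; exists 0 => // x y.
    by rewrite subrr normr0.
  by exists e => // x y; apply: le_trans (ha x y) (ltW aeps).
split=> // B [BM oB] [d Bd]; have [eps eps0 hB] := oB d Bd.
have [|e Ae he] := dA d (eps / 2) (BM _ Bd); first by lra.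
exists e; split=> //; apply: hB; first exact: AM.
by apply: le_lt_trans (DX_le he) _; rewrite lte_fin; lra.
Qed.

Lemma unif_disconnected_chain d : is_metric d -> unif_disconnected d ->
  exists2 delta : R, 0 < delta < 1 & forall (N : nat) (z : nat -> X),
    delta * d (z 0%N) (z N) <= \big[Num.max/0]_(i < N) d (z i) (z i.+1).
Proof.
move=> md [delta hdelta h]; exists delta => // N z.
have [zz|nzz] := pselect (z 0%N = z N); last by apply: h; exists 0%N, N.
rewrite zz (metric_refl md) mulr0.
exact: (bigmax_ord_ge0 N (fun i => d (z i) (z i.+1))).
Qed.

Lemma UD_Fsigma : Fsigma_in_Met (@UD R X).
Proof.
(* The constants [n.+2%:R^-1] lie strictly below 1 and tend to 0, and a metric admitting [delta]
   admits every smaller constant. *)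
pose F (n : nat) : set (X -> X -> R) := [set d | Met d /\
  forall (N : nat) (z : nat -> X), n.+2%:R^-1 * d (z 0%N) (z N) <=
    \big[Num.max/0]_(i < N) d (z i) (z i.+1)].
have inv2 n : 0 < (n.+2%:R^-1 : R) < 1.
  by rewrite invr_gt0 ltr0n invf_lt1 ?ltr0n ?ltr1n.
exists F; split=> [n|].
  split=> [d []//|]; split=> [d []//|d [Md nFd]].
  have [N [z hz]] : exists N (z : nat -> X),
      \big[Num.max/0]_(i < N) d (z i) (z i.+1) < n.+2%:R^-1 * d (z 0%N) (z N).
    apply: contrapT => h; apply: nFd; split=> // N z.
    by rewrite leNgt; apply/negP => hz; apply: h; exists N, z.
  set B := \big[_/_]_(_ < _) _ in hz; set D := n.+2%:R^-1 * _ in hz.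
  (* Half the gap of a violating chain suffices: the maximum rises by at most that much, and the
     scaled end distance, its factor being below 1, drops by less. *)
  exists ((D - B) / 2) => [|e Me de]; first by lra.
  split=> // -[_ /(_ N z)]; apply/negP; rewrite -ltNge.
  apply: (@le_lt_trans _ _ (B + (D - B) / 2)).
    apply: (@bigmax_ord_le R N (fun i => e (z i) (z i.+1))) => [|i iN].
      have : 0 <= B := bigmax_ord_ge0 N (fun i => d (z i) (z i.+1)).
      by lra.
    have := bigmax_ord_ge (fun i => d (z i) (z i.+1)) iN.
    by have := DX_lt (z i) (z i.+1) de; rewrite ltr_norml /B; lra.
  have := DX_lt (z 0%N) (z N) de; rewrite ltr_norml => /andP[_ h].
  have /andP[c0 c1] := inv2 n; set g := (D - B) / 2 in h *.
  have g0 : 0 < g by rewrite /g; lra.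
  have -> : B + g = D - g by rewrite /g; lra.
  rewrite ltrBlDr -ltrBlDl /D -mulrBr.
  have [dle|dlt] := leP (d (z 0%N) (z N) - e (z 0%N) (z N)) 0.
    by apply: le_lt_trans g0; rewrite pmulr_rle0.
  by apply: le_lt_trans h; rewrite ler_piMl ?ltW.
apply/seteqP; split=> [d [Md ud]|d [n _ [Md h]]]; last first.
  by split=> //; exists n.+2%:R^-1 => // N z _; apply: h.
have [delta /andP[delta0 _] h] := unif_disconnected_chain Md.1 ud.
have [n ndelta] := invSn_lt delta0.
exists n => //; split=> // N z; apply: le_trans (h N z).
apply: ler_wpM2r; first exact: metric_ge0 Md.1 _ _.
by apply: le_trans (ltW ndelta); rewrite lef_pV2 ?posrE ?ltr0n // ler_nat.
Qed.

(** * Ultrametrics and uniform disconnectedness *)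

Lemma ultra_chain (u : X -> X -> R) (B : R) (N : nat) (z : nat -> X) :
  (forall x, u x x = 0) ->
  (forall x y z, u x z <= Num.max (u x y) (u y z)) ->
  0 <= B -> (forall i, (i < N)%N -> u (z i) (z i.+1) <= B) ->
  u (z 0%N) (z N) <= B.
Proof.
move=> u0 uT B0; elim: N => [|N IH] h; first by rewrite u0.
apply: le_trans (uT _ (z N) _) _; rewrite ge_max h // andbT.
by apply: IH => i iN; apply: h; apply: ltnW.
Qed.

(** The [u]-distance of the ends of a chain is at most its largest [u]-step, and the two-sided
    comparison transfers this to [e] up to a constant. Since [c / K] need not be below 1,
    [c / (K + c)] is used. *)
Lemma unif_disconnected_ultra (u e : X -> X -> R) (c K : R) :
  (forall x, u x x = 0) ->
  (forall x y z, u x z <= Num.max (u x y) (u y z)) ->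
  0 < c -> 0 < K -> (forall x y, c * u x y <= e x y) ->
  (forall x y, e x y <= K * u x y) -> unif_disconnected e.
Proof.
move=> u0 uT c0 K0 ce eK; exists (c / (K + c)).
  by rewrite divr_gt0 ?addr_gt0 //= ltr_pdivrMr ?addr_gt0 // mul1r; lra.
move=> N z _; set B := \big[_/_]_(_ < _) _.
have B0 : 0 <= B := bigmax_ord_ge0 N (fun i => e (z i) (z i.+1)).
have uB : u (z 0%N) (z N) <= B / c.
  apply: (ultra_chain u0 uT) => // [|i iN]; first by rewrite divr_ge0 // ltW.
  rewrite ler_pdivlMr // mulrC; apply: le_trans (ce _ _) _.
  exact: (bigmax_ord_ge (fun i => e (z i) (z i.+1))).
rewrite mulrAC ler_pdivrMr ?addr_gt0 //.
move: (eK (z 0%N) (z N)); move: uB; rewrite ler_pdivlMr //.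
by nra.
Qed.

End Metrics.

(** * From compactness and dimension 0 to density *)

Section CompactToDense.
Variables (R : realType) (X : topologicalType).
Implicit Types (d e : X -> X -> R) (x y : X).

Lemma compact_totally_bounded d (r : R) : compact [set: X] -> Met d -> 0 < r ->
  exists s : seq X, forall x, exists2 a, a \in s & d a x < r.
Proof.
move=> cX Md r0; apply: contrapT => noNet.
(* [F] is generated by the complements of finite unions of [r]-balls; a cluster point would
   contradict its own ball. *)
pose F : set_system X := [set A | exists s : seq X,
  forall x, (forall a, a \in s -> r <= d a x) -> A x].
have FF : ProperFilter F.
  split=> [[s hs]|].
    apply: noNet; exists s => x; apply: contrapT => h; apply: (hs x) => a sa.
    by rewrite leNgt; apply/negP => ar; apply: h; exists a.
  split=> [|A B [s hs] [t ht]|A B AB [s hs]].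
  - by exists [::].
  - exists (s ++ t) => x h; split.
      by apply: hs => a sa; apply: h; rewrite mem_cat sa.
    by apply: ht => a sa; apply: h; rewrite mem_cat sa orbT.
  - by exists s => x /hs /AB.
have FT : F [set: X] by exists [::].
have [x [_ clx]] := cX F FF FT.
have FA : F [set y | r <= d x y].
  by exists [:: x] => y; apply; rewrite inE.
have [y /= [h1 h2]] := clx _ _ FA (nbhs_metric_ball x Md r0).
by move: h2; rewrite ltNge h1.
Qed.

Lemma compact_bounded d x0 : compact [set: X] -> Met d ->
  exists2 M : R, 0 < M & forall x y, d x y <= M.
Proof.
move=> cX Md; have md := Md.1.
have [s hs] := compact_totally_bounded cX Md ltr01.
have [M M0 hM] : exists2 M : R, 0 <= M & forall a, a \in s -> d x0 a <= M.
  elim: s {hs} => [|b s [M M0 IH]]; first by exists 0.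
  exists (Num.max M (d x0 b)) => [|a]; first by rewrite le_max M0.
  rewrite inE le_max => /predU1P[->|/IH ->//].
  by rewrite lexx orbT.
exists (2 * (M + 1)) => [|x y]; first by lra.
have [a /hM ha ax] := hs x; have [b /hM hb b_y] := hs y.
have := metric_triangle md x x0 y; rewrite (metric_sym md x x0).
by have := metric_triangle md x0 a x; have := metric_triangle md x0 b y; lra.
Qed.

(** The disjoint refinement of a finite cover by balls of radius [r / 2] is a partition, and [p] is
    the index of the block: openness of the blocks makes [p] locally constant. *)
Lemma small_partition d (r : R) :
  covering_dim_le0 X -> compact [set: X] -> Met d -> 0 < r ->
  exists p : X -> nat,
    (forall x, exists2 s : R, 0 < s & forall y, d x y < s -> p x = p y) /\
    (forall x y, p x = p y -> d x y < r).
Proof.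
move=> dimX cX Md r0; have md := Md.1; have r20 : 0 < r / 2 by lra.
have [s hs] := compact_totally_bounded cX Md r20.
pose U (i : 'I_(size s)) := [set y | d (tnth (in_tuple s) i) y < r / 2].
have oU i : open (U i) by apply: open_metric_ball.
have cU : \bigcup_i U i = [set: X].
  apply/seteqP; split=> // x _; have [a /(tnthP (in_tuple s)) [i ->] h] := hs x.
  by exists i.
have [m [V [oV cV VU dV]]] := dimX _ U oU cU.
have /choice [q Vq] : forall x, exists j, V j x.
  by move=> x; have : [set: X] x by []; rewrite -cV => -[j _]; exists j.
exists (fun x => q x : nat); split=> [x|x y /val_inj qxy].
  have [s' s'0 h] := nbhs_metric Md (open_nbhs_nbhs (conj (oV (q x)) (Vq x))).
  exists s' => // y /h Vy; congr nat_of_ord; apply: contrapT => /dV.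
  by apply/eqP/set0P; exists y.
have [i VUi] := VU (q x); have /VUi hx := Vq x.
have : V (q x) y by rewrite qxy.
move=> /VUi; rewrite /U /= in hx * => hy; move: hx.
by have := metric_triangle md x (tnth (in_tuple s) i) y;
  rewrite (metric_sym md x (tnth _ _)); lra.
Qed.

(* [p n] is the label function of the n-th partition. *)
Definition partition_dist (p : nat -> X -> nat) x y : R :=
  sup (range (fun n => (p n x != p n y)%:R / n.+1%:R : R)).

Lemma partition_dist_term (p : nat -> X -> nat) x y n :
  (p n x != p n y)%:R / n.+1%:R <= partition_dist p x y.
Proof.
apply: ub_le_sup; last by exists n.
exists 1 => _ [k _ <-]; rewrite ler_pdivrMr ?ltr0n // mul1r ler_nat.
by case: (_ != _).
Qed.

Lemma partition_dist_ge0 p x y : 0 <= partition_dist p x y.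
Proof. by apply: le_trans (partition_dist_term p x y 0); rewrite divr_ge0. Qed.

Lemma partition_dist_ge (p : nat -> X -> nat) x y n :
  p n x <> p n y -> n.+1%:R^-1 <= partition_dist p x y.
Proof.
by move=> /eqP h; have := partition_dist_term p x y n; rewrite h mul1r.
Qed.

Lemma partition_dist_le (p : nat -> X -> nat) x y (B : R) : 0 <= B ->
  (forall n, p n x <> p n y -> n.+1%:R^-1 <= B) -> partition_dist p x y <= B.
Proof.
move=> B0 h; apply: ge_sup; first by eexists; exists 0%N.
move=> _ [n _ <-]; case: (eqVneq (p n x) (p n y)) => [_|/eqP/h].
  by rewrite mul0r.
by rewrite mul1r.
Qed.

Lemma partition_dist_refl p x : partition_dist p x x = 0.
Proof.
by apply/eqP; rewrite eq_le partition_dist_ge0 andbT partition_dist_le.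
Qed.

Lemma partition_dist_sym p x y : partition_dist p x y = partition_dist p y x.
Proof.
rewrite /partition_dist; congr sup; apply/seteqP.
by split=> _ [n _ <-]; exists n; rewrite // eq_sym.
Qed.

(** A partition separating [x] from [z] separates [y] from one of them. *)
Lemma partition_dist_ultra p x y z : partition_dist p x z <=
  Num.max (partition_dist p x y) (partition_dist p y z).
Proof.
apply: partition_dist_le => [|n pxz]; first by rewrite le_max partition_dist_ge0.
rewrite le_max; have [pxy|pxy] := pselect (p n x = p n y); last first.
  by rewrite partition_dist_ge.
by rewrite (@partition_dist_ge p y z n) ?orbT // -pxy.
Qed.

Lemma UD_approx d (eps : R) :
  covering_dim_le0 X -> compact [set: X] -> Met d -> 0 < eps ->
  exists2 e, UD e & forall x y, `|d x y - e x y| <= eps.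
Proof.
move=> dimX cX Md eps0; have md := Md.1.
(* On the empty space [d] itself is vacuously uniformly disconnected; otherwise [x0] is the default
   representative of labels not taken by [p k]. *)
have [[x0 _]|nX] := pselect (exists x : X, True); last first.
  exists d => [|x]; last by case: nX; exists x.
  split=> //; exists (1 / 2) => [|N z]; first by apply/andP; split; lra.
  by case: nX; exists (z 0%N).
have /choice [p hp] : forall n, exists p : X -> nat,
    (forall x, exists2 s : R, 0 < s & forall y, d x y < s -> p x = p y) /\
    (forall x y, p x = p y -> d x y < n.+1%:R^-1).
  by move=> n; apply: small_partition => //; rewrite invr_gt0.
have [M M0 dM] := compact_bounded x0 cX Md.
have [k keps] : exists k, k.+1%:R^-1 < eps / 4 by apply: invSn_lt; lra.
set u := partition_dist p.
have u0 x : u x x = 0 by apply: partition_dist_refl.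
have uge0 x y : 0 <= u x y by apply: partition_dist_ge0.
have u1 x y : u x y <= 1.
  by apply: partition_dist_le => // n _; rewrite invf_le1 ?ltr0n // ler1n.
have uT : forall x y z, u x z <= Num.max (u x y) (u y z).
  by move=> x y z; apply: partition_dist_ultra.
have /choice [h hh] : forall n, exists y, forall x, p k x = n -> p k y = n.
  move=> n; have [[y py]|np] := pselect (exists y, p k y = n).
    by exists y.
  by exists x0 => x px; case: np; exists x.
pose f x := h (p k x).
have pf x : p k (f x) = p k x by apply: hh (erefl _).
have df x : d x (f x) < eps / 4.
  by apply: lt_trans keps; apply: (hp k).2.
(* Moving both points to their representatives changes [d] by less than [eps / 2], and as [u <= 1]
   the added term is at most [eps / 4]. *)
pose c := eps / 4; have c0 : 0 < c by rewrite /c; lra.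
(* If the k-th partition separates [x] and [y], then [u x y >= 1/(k+1)] and [M * k.+1%:R * u x y]
   dominates the bounded [d]; if not, [f x = f y]. *)
pose K := M * k.+1%:R + c; have K0 : 0 < K by rewrite addr_gt0 ?mulr_gt0.
pose e x y := d (f x) (f y) + c * u x y.
have ce x y : c * u x y <= e x y.
  by rewrite /e lerDr metric_ge0.
have eK x y : e x y <= K * u x y.
  rewrite /e /K mulrDl lerD2r.
  have [pxy|pxy] := pselect (p k x = p k y).
    by rewrite /f pxy (metric_refl md) !mulr_ge0 // ltW.
  apply: le_trans (dM _ _) _; rewrite -mulrA ler_peMr ?(ltW M0) //.
  by rewrite mulrC -ler_pdivrMr ?ltr0n // mul1r partition_dist_ge.
have u_small x y n : u x y < n.+1%:R^-1 -> d x y < n.+1%:R^-1.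
  move=> uxy; apply: (hp n).2; apply: contrapT => /(partition_dist_ge (p := p)).
  by rewrite leNgt uxy.
have me : is_metric e.
  split; [|split] => [x y|x y|x y z].
  - split=> [exy|->]; last by rewrite /e u0 mulr0 addr0 (metric_refl md).
    have uxy : u x y = 0.
      apply/eqP; rewrite eq_le uge0 andbT.
      by have := ce x y; rewrite exy pmulr_rle0.
    apply/(md.1 x y)/eqP; rewrite eq_le (metric_ge0 md) andbT leNgt.
    apply/negP => /invSn_lt [n]; apply/negP; rewrite -leNgt ltW // u_small //.
    by rewrite uxy invr_gt0.
  - by rewrite /e (metric_sym md) /u partition_dist_sym.
  - have hd := metric_triangle md (f x) (f y) (f z).
    have : c * u x z <= c * u x y + c * u y z.
      rewrite -mulrDr ler_pM2l //; apply: le_trans (uT x y z) _.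
      by rewrite ge_max lerDl lerDr !uge0.
    by rewrite /e; lra.
exists e; last first.
  move=> x y; rewrite /e.
  have cu : 0 <= c * u x y <= c.
    by rewrite mulr_ge0 ?(ltW c0) //= ler_piMr ?(ltW c0).
  have := metric_triangle md x (f x) y; have := metric_triangle md (f x) (f y) y.
  have := metric_triangle md (f x) x (f y); have := metric_triangle md x y (f y).
  rewrite (metric_sym md (f x) x) (metric_sym md (f y) y).
  by move: cu (df x) (df y); rewrite /c ler_norml; lra.
split; last exact: unif_disconnected_ultra u0 uT c0 K0 ce eK.
apply: (Met_equiv Md me) => x r r0.
- have [n nr] : exists n, n.+1%:R^-1 < r / K.
    by apply: invSn_lt; rewrite divr_gt0.
  (* Near [x] the first [n] labels are all constant, so only terms of [u] with index at least [n]
     survive. *)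
  have [s s0 hs] : exists2 s : R, 0 < s & forall y, d x y < s ->
      forall j, (j < n)%N -> p j x = p j y.
    elim: (n) => [|m [s s0 IH]]; first by exists 1.
    have [t t0 ht] := (hp m).1 x.
    exists (Num.min s t) => [|y]; first by rewrite lt_min s0.
    rewrite lt_min => /andP[/IH ys /ht yt] j.
    by rewrite ltnS leq_eqVlt => /predU1P[->|/ys].
  exists s => // y /hs xy; apply: le_lt_trans (eK x y) _.
  rewrite mulrC -ltr_pdivlMr //; apply: le_lt_trans nr.
  apply: partition_dist_le => [|j]; first by rewrite invr_ge0.
  have [/xy//|nj _] := ltnP j n.
  by rewrite lef_pV2 ?posrE ?ltr0n // ler_nat.
- have [n nr] := invSn_lt r0.
  exists (c * n.+1%:R^-1) => [|y exy]; first by rewrite mulr_gt0 // invr_gt0.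
  apply: lt_trans nr; apply: u_small.
  by rewrite -(ltr_pM2l c0); apply: le_lt_trans (ce x y) exy.
Qed.

End CompactToDense.

(** * From density to compactness and dimension 0 *)

Section DenseToCompact.
Variables (R : realType) (X : topologicalType).
Implicit Types (d e : X -> X -> R) (x y : X).

Hypothesis UD_dense : dense_in_Met (@UD R X).

(* An unbounded [f] admits points [b n] on which it grows by at least 1 at each
   step; flattening it to [g] with [g (b n) = n] gives [min d 1 + |g x - g y|],
   for which the chain [b 0, b 1, ...] has bounded steps and is unbounded. *)
Lemma continuous_bounded_above d (f : X -> R) : Met d ->
  (forall x (r : R), 0 < r ->
     exists2 s : R, 0 < s & forall y, d x y < s -> `|f x - f y| < r) ->
  exists M, forall x, f x <= M.
Proof.
move=> Md fc; have md := Md.1; apply: contrapT => unbd.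
have big M : exists x, M < f x.
  apply: contrapT => h; apply: unbd; exists M => x.
  by rewrite leNgt; apply/negP => Mx; apply: h; exists x.
have [x0 _] := big 0.
have /choice [nxt hnxt] : forall y, exists x, f y + 1 < f x.
  by move=> y; apply: big.
pose b n := iter n nxt x0.
have fb m n : f (b m) + n%:R <= f (b (m + n)%N).
  elim: n => [|n IH]; first by rewrite addr0 addn0.
  rewrite addnS -natr1; have := hnxt (b (m + n)%N).
  by rewrite -/(b (m + n).+1); lra.
have fbb m n : m%:R <= n%:R + `|f (b m) - f (b n)|.
  have [mn|/ltnW nm] := leqP m n.
    by apply: le_trans (_ : n%:R <= _); rewrite ?ler_nat // lerDl.
  have := fb n (m - n)%N; rewrite subnKC // natrB // => h.
  by have := ler_norm (f (b m) - f (b n)); lra.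
pose S x := range (fun n : nat => n%:R + `|f x - f (b n)|).
have S0 x : S x !=set0 by eexists; exists 0%N.
have Slb x : has_lbound (S x) by exists 0 => _ [n _ <-]; rewrite addr_ge0.
(* This is the McShane extension of [b n |-> n] for the pseudometric [|f x - f y|]; [fbb] says that
   these prescribed values are 1-Lipschitz. *)
pose g x := inf (S x).
have gle x y : g x - g y <= `|f x - f y|.
  rewrite lerBlDr addrC -lerBlDr; apply: lb_le_inf => // _ [n _ <-].
  rewrite lerBlDr; apply: le_trans (_ : _ <= n%:R + `|f x - f (b n)|) _.
    by apply: ge_inf => //; exists n.
  by have := ler_distD (f y) (f x) (f (b n)); lra.
have gf x y : `|g x - g y| <= `|f x - f y|.
  by rewrite ler_norml gle andbT; have := gle y x; rewrite distrC; lra.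
have gb m : g (b m) = m%:R.
  apply/eqP; rewrite eq_le; apply/andP; split.
    by apply: ge_inf => //; exists m => //; rewrite subrr normr0 addr0.
  by apply: lb_le_inf => // _ [n _ <-].
pose rho x y := Num.min (d x y) 1 + `|g x - g y|.
have dmin_ge0 x y : 0 <= Num.min (d x y) 1.
  by rewrite le_min (metric_ge0 md) ler01.
have mrho : is_metric rho.
  split; [|split] => [x y|x y|x y z].
  - split=> [/eqP|->]; last first.
      by rewrite /rho (metric_refl md) subrr normr0 addr0 minEle ler01.
    rewrite paddr_eq0 // => /andP[h _]; apply/md.1; move: h.
    by rewrite minEle; case: leP => _ /eqP // /eqP; rewrite oner_eq0.
  - by rewrite /rho (metric_sym md) distrC.
  - have := ler_distD (g y) (g x) (g z).
    have := metric_triangle md x y z.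
    have := metric_ge0 md x y; have := metric_ge0 md y z.
    rewrite /rho !minEle.
    by case: (leP (d x z) 1); case: (leP (d x y) 1); case: (leP (d y z) 1); lra.
have Mrho : Met rho.
  apply: (Met_equiv Md mrho) => x r r0.
    have r20 : 0 < r / 2 by lra.
    have [s s0 hs] := fc x _ r20.
    exists (Num.min s (r / 2)) => [|y]; first by rewrite lt_min s0.
    rewrite lt_min => /andP[/hs hf hd]; rewrite /rho.
    have : Num.min (d x y) 1 <= d x y by rewrite ge_min lexx.
    by have := gf x y; lra.
  exists (Num.min r 1) => [|y]; first by rewrite lt_min r0 ltr01.
  rewrite /rho lt_min => /andP[h1 h2].
  have := normr_ge0 (g x - g y); move: h1 h2.
  by rewrite minEle; case: (leP (d x y) 1); lra.
have /dense_in_MetP : @UD R X `<=` @Met R X by move=> ? [].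
case=> /(_ UD_dense) /(_ rho 1 Mrho ltr01) [e [Me ue] he] _.
have [delta /andP[delta0 _] hd] := unif_disconnected_chain Me.1 ue.
(* Steps of the chain have [rho]-length at most 2, hence [e]-length at most 3, while
   [e (b 0) (b N) >= N - 1 > 3 / delta]. *)
pose N := (Num.truncn (3 / delta)).+2.
have := hd N b; apply/negP; rewrite -ltNge.
apply: (@le_lt_trans _ _ 3).
  apply: (bigmax_ord_le (f := fun i => e (b i) (b i.+1))) => // i _.
  have := he (b i) (b i.+1); rewrite /rho !gb -natr1 ler_norml.
  have -> : i%:R - (i%:R + 1) = -1 :> R by lra.
  rewrite normrN1; have : Num.min (d (b i) (b i.+1)) 1 <= 1.
    by rewrite ge_min lexx orbT.
  by lra.
rewrite mulrC -ltr_pdivrMr //; have := he (b 0%N) (b N); rewrite ler_norml.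
have := truncnS_gt (3 / delta); have := dmin_ge0 (b 0%N) (b N).
by rewrite /rho !gb sub0r normrN normr_nat /N -(natr1 (Num.truncn _).+1); lra.
Qed.

Lemma lipschitz_bounded_below d (lam : X -> R) : Met d ->
  (forall x, 0 < lam x) -> (forall x y, lam x <= lam y + d x y) ->
  exists2 eta : R, 0 < eta & forall x, eta <= lam x.
Proof.
move=> Md lam0 lamd; have md := Md.1.
have [x r r0|M hM] := continuous_bounded_above (f := fun x => (lam x)^-1) Md.
  have l0 := lam0 x.
  (* The first bound gives [lam y > lam x / 2], so the inverses differ by at most
     [d x y / (lam x * lam y)], which the second bound makes less than [r]. *)
  exists (Num.min (lam x / 2) (r * (lam x * (lam x / 2)))) => [|y].
    by rewrite lt_min !mulr_gt0 // ?invr_gt0.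
  rewrite lt_min => /andP[h1 h2].
  have := lamd x y; have := lamd y x; rewrite (metric_sym md y x) => hyx hxy.
  have ly : lam x / 2 < lam y by lra.
  have ly0 : 0 < lam y by lra.
  have -> : (lam x)^-1 - (lam y)^-1 = (lam y - lam x) / (lam x * lam y).
    by field; rewrite !gt_eqF.
  rewrite normrM normfV (gtr0_norm (mulr_gt0 l0 ly0)) ltr_pdivrMr ?mulr_gt0 //.
  apply: le_lt_trans (_ : _ <= d x y) _; first by rewrite ler_norml; lra.
  by apply: lt_trans h2 _; rewrite !ltr_pM2l.
exists (Num.max M 1)^-1 => [|x]; first by rewrite invr_gt0 lt_max ltr01 orbT.
rewrite -[lam x]invrK lef_pV2 ?posrE ?invr_gt0 ?lt_max ?ltr01 ?orbT //.
by rewrite le_max hM.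
Qed.

(** Otherwise there is an [r]-separated sequence [a], and the infimum over [n] of
    [d x (a n) + 1/(n+1)] is a positive 1-Lipschitz function that is at most [1/(n+1)] at [a n], so
    not bounded away from 0. *)
Lemma dense_totally_bounded d (r : R) : Met d -> 0 < r ->
  exists s : seq X, forall x, exists2 a, a \in s & d a x < r.
Proof.
move=> Md r0; have md := Md.1; apply: contrapT => noNet.
have /choice [F hF] : forall s : seq X, exists x,
    forall a, a \in s -> r <= d a x.
  move=> s; apply: contrapT => h; apply: noNet; exists s => x.
  apply: contrapT => hx; apply: h; exists x => a sa.
  by rewrite leNgt; apply/negP => ar; apply: hx; exists a.
pose ss n := iter n (fun s => F s :: s) [::].
pose a n := F (ss n).
have a_in i j : (i < j)%N -> a i \in ss j.
  elim: j => // j IH; rewrite ltnS leq_eqVlt inE => /predU1P[->|/IH ->].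
    by rewrite eqxx.
  by rewrite orbT.
have sep i j : i <> j -> r <= d (a i) (a j).
  move=> /eqP; rewrite neq_ltn => /orP[ij|ji]; first exact/hF/a_in.
  by rewrite (metric_sym md); apply/hF/a_in.
pose S x := range (fun n : nat => d x (a n) + n.+1%:R^-1).
have S0 x : S x !=set0 by eexists; exists 0%N.
have Slb x : has_lbound (S x).
  by exists 0 => _ [n _ <-]; rewrite addr_ge0 ?invr_ge0 ?(metric_ge0 md).
have infS x n : inf (S x) <= d x (a n) + n.+1%:R^-1.
  by apply: ge_inf => //; exists n.
have [x|x y|eta eta0 heta] :=
    @lipschitz_bounded_below d (fun x => inf (S x)) Md.
(* Positivity: a point within [r / 2] of [a n] is at least [r / 2] away from every other [a m]. *)
- have [[n xn]|far] := pselect (exists n, d x (a n) < r / 2).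
    apply: (@lt_le_trans _ _ (Num.min (r / 2) n.+1%:R^-1)).
      by rewrite lt_min invr_gt0 ltr0n andbT; lra.
    apply: lb_le_inf => // _ [m _ <-]; rewrite ge_min.
    have [->|/sep nm] := pselect (m = n).
      by rewrite lerDr (metric_ge0 md) orbT.
    apply/orP; left; apply: ler_wpDr; first by rewrite invr_ge0.
    by have := metric_triangle md (a m) x (a n); rewrite (metric_sym md _ x); lra.
  apply: (@lt_le_trans _ _ (r / 2)); first by lra.
  apply: lb_le_inf => // _ [m _ <-]; apply: ler_wpDr; first by rewrite invr_ge0.
  by rewrite leNgt; apply/negP => h; apply: far; exists m.
- rewrite -lerBlDr; apply: lb_le_inf => // _ [n _ <-].
  rewrite lerBlDr; apply: le_trans (infS x n) _.
  by rewrite [leRHS]addrAC lerD2r [leRHS]addrC metric_triangle.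
- have [n] := invSn_lt eta0; apply/negP; rewrite -leNgt.
  apply: le_trans (heta (a n)) _; apply: le_trans (infS _ n) _.
  by rewrite (metric_refl md) add0r.
Qed.

(* A Lebesgue number lemma; [P x r] stands for a property, inherited by smaller
   balls, of the ball of centre [x] and radius [r]. *)
Lemma uniform_radius d (P : X -> R -> Prop) : Met d ->
  (forall x y (r s : R), P x r -> s + d x y <= r -> P y s) ->
  (forall x, exists2 r : R, 0 < r & P x r) ->
  exists2 eta : R, 0 < eta & forall x, P x eta.
Proof.
move=> Md Pmono Ploc; have md := Md.1.
(* Capping radii at 1 keeps the supremum finite; [Pmono] makes it 1-Lipschitz in [x]. *)
pose S x := [set r : R | r <= 1 /\ P x r].
have Sub x : has_ubound (S x) by exists 1 => r [].
have Spos x : exists2 r, 0 < r & S x r.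
  have [r r0 Pr] := Ploc x; exists (Num.min r 1).
    by rewrite lt_min r0 ltr01.
  split; first by rewrite ge_min lexx orbT.
  by apply: Pmono Pr _; rewrite (metric_refl md) addr0 ge_min lexx.
have S0 x : S x !=set0 by have [r _ Sr] := Spos x; exists r.
have [x|x y|eta eta0 heta] :=
    @lipschitz_bounded_below d (fun x => sup (S x)) Md.
- by have [r r0 Sr] := Spos x; apply: lt_le_trans r0 _; apply: ub_le_sup.
- apply: ge_sup => // r [r1 Pr]; rewrite -lerBlDr; apply: ub_le_sup => //.
  split; first by have := metric_ge0 md x y; lra.
  by apply: Pmono Pr _; rewrite subrK.
- exists (eta / 2) => [|x]; first by lra.
  have h : eta / 2 < sup (S x) by have := heta x; lra.
  have [r [_ Pr] hr] := sup_gt (S0 x) h.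
  by apply: Pmono Pr _; rewrite (metric_refl md) addr0 ltW.
Qed.

(** Without cluster points, each ball of some uniform radius [eta] misses a member of the filter.
    Intersecting these members over a finite [eta]-net gives a member missing all of [X]. *)
Lemma dense_compact d : Met d -> compact [set: X].
Proof.
move=> Md F FF _; have md := Md.1; apply: contrapT => nocl.
pose P x (r : R) := exists2 A, F A & forall y, A y -> r <= d x y.
have [x y r s [A FA hA] hs|x|eta eta0 heta] := @uniform_radius d P Md.
- exists A => // z /hA; have := metric_triangle md x y z.
  by lra.
- apply: contrapT => h; apply: nocl; exists x; split=> // A B FA.
  move=> /(nbhs_metric Md) [r r0 rB]; apply: contrapT => AB0.
  apply: h; exists r => //; exists A => // y Ay; rewrite leNgt.
  by apply/negP => xy; apply: AB0; exists y; split=> //; apply: rB.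
have [s hs] := dense_totally_bounded Md eta0.
have [A FA hA] : exists2 A, F A &
    forall a, a \in s -> forall y, A y -> eta <= d a y.
  elim: s {hs} => [|a s [A FA hA]]; first by exists setT => //; apply: filterT.
  have [B FB hB] := heta a.
  exists (A `&` B) => [|b]; first exact: filterI.
  by rewrite inE => /predU1P[->|/hA {}hA] y [Ay By]; [apply: hB | apply: hA].
have [y Ay] := filter_ex FA.
have [a sa] := hs y; apply/negP; rewrite -leNgt.
exact: hA.
Qed.

Lemma dense_covering_dim d : Met d -> covering_dim_le0 X.
Proof.
move=> Md n U oU cU.
(* Density supplies a uniformly disconnected [e] in [Met]; balls and chains below are measured by
   [e]. *)
have /dense_in_MetP : @UD R X `<=` @Met R X by move=> ? [].
case=> /(_ UD_dense) /(_ d 1 Md ltr01) [e [Me ue] _] _.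
have me := Me.1.
have [delta /andP[delta0 _] hd] := unif_disconnected_chain me ue.
pose P x (r : R) := exists i, forall y, e x y < r -> U i y.
have [x y r s [i hi] hs|x|eta eta0 heta] := @uniform_radius e P Me.
- by exists i => z yz; apply: hi; have := metric_triangle me x y z; lra.
- have : [set: X] x by []; rewrite -cU => -[i _ Ux].
  have [r r0 rU] := nbhs_metric Me (open_nbhs_nbhs (conj (oU i) Ux)).
  by exists r => //; exists i.
(* Uniform disconnectedness turns steps below [delta * eta] into end distance below [eta], so each
   chain class lies in a ball contained in some [U i]. *)
pose t := delta * eta; have t0 : 0 < t by rewrite mulr_gt0.
pose C x y := exists N (z : nat -> X),
  [/\ z 0%N = x, z N = y & forall i, (i < N)%N -> e (z i) (z i.+1) < t].
have Cstep x y y' : C x y -> e y y' < t -> C x y'.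
  move=> [N [z [z0 zN hz]]] yy'.
  exists N.+1, (fun i => if (i <= N)%N then z i else y'); split=> //.
    by rewrite ltnn.
  move=> i; rewrite ltnS => iN; rewrite iN; move: iN.
  by rewrite leq_eqVlt => /predU1P[->|iN]; rewrite ?ltnn ?zN // iN; apply: hz.
have Csmall x y : C x y -> e x y < eta.
  move=> [N [z [<- <- hz]]]; rewrite -(ltr_pM2l delta0).
  apply: le_lt_trans (hd N z) _; apply: bigmax_lt => // i _; exact: hz.
have [s hs] := dense_totally_bounded Me t0.
pose a (j : 'I_(size s)) := tnth (in_tuple s) j.
(* Removing the earlier classes keeps [V j] and [V k] disjoint even when [a j]
   and [a k] lie in the same class. *)
pose V j := [set x | C (a j) x /\
  forall k : 'I_(size s), (k < j)%N -> ~ C (a k) x].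
exists (size s), V; split.
(* A move shorter than [t] stays in the same chain class, so both conditions defining [V j]
   persist. *)
- move=> j; apply/Me.2 => x [Cx nC]; exists t => // y /= xy; split.
    exact: Cstep Cx xy.
  by move=> k kj Cy; apply: (nC k kj); apply: Cstep Cy _; rewrite (metric_sym me).
- apply/seteqP; split=> // x _.
  have [_ /(tnthP (in_tuple s)) [i ->] ix] := hs x.
  have Ci : `[< C (a i) x >].
    apply/asboolP; apply: Cstep ix; exists 0%N, (fun=> a i).
    by split.
  (* The [t]-net puts [x] in the class of some [a i]; the least such index gives the [V j]
     containing [x]. *)
  case: (@arg_minnP _ i (fun j => `[< C (a j) x >]) val Ci) => j /asboolP Cj jmin.
  exists j => //; split=> // k kj /asboolP /jmin; apply/negP.
  by rewrite -ltnNge.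
- move=> j; have [i hi] := heta (a j); exists i => x [Cx _].
  exact/hi/Csmall.
- have dis (j k : 'I_(size s)) : (j < k)%N -> V j `&` V k = set0.
    by move=> jk; apply/seteqP; split=> // x [[Cj _] [_ /(_ j jk)]].
  move=> j k /eqP; rewrite -(inj_eq val_inj) neq_ltn => /orP[/dis//|/dis].
  by rewrite setIC.
Qed.

End DenseToCompact.

Theorem theorem1p2 (R : realType) (X : topologicalType) :
  @metrizable R X ->
  (covering_dim_le0 X /\ compact [set: X]) <->
  (dense_in_Met (@UD R X) /\ Fsigma_in_Met (@UD R X)).
Proof.
move=> [d Md]; split=> [[dimX cX]|[UDd _]].
  split; last exact: UD_Fsigma.
  apply/dense_in_MetP; first by move=> ? [].
  by move=> e eps Me eps0; apply: UD_approx.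
by split; [apply: (dense_covering_dim UDd Md) | apply: (dense_compact UDd Md)].
Qed.
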